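(* Let $(M,d)$ be a metric space and let $T:M\to M$ be a surjective uniformly asymptotically regular mapping. Then $T$ is the identity mapping on $M$.
   Context: A mapping $T:M\to M$ on a metric space $(M,d)$ is uniformly asymptotically regular (UAR) if $\lim_{n\to\infty}\sup_{x\in M} d(T^{n+1}x,T^{n}x)=0$, where $T^n$ is the $n$-fold composition of $T$. *)

(* Defs.v *)
From Stdlib Require Import Reals.
Open Scope R_scope.

Definition is_metric {M : Type} (d : M -> M -> R) : Prop :=
  (forall x y, 0 <= d x y) /\
  (forall x y, d x y = 0 <-> x = y) /\
  (forall x y, d x y = d y x) /\
  (forall x y z, d x z <= d x y + d y z).

Fixpoint iter_map {M : Type} (n : nat) (T : M -> M) (x : M) : M :=
  match n with
  | O => x
  | S k => T (iter_map k T x)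
  end.

(* Uniform asymptotic regularity: lim_n sup_x d(T^{n+1}x, T^n x) = 0.
   Written as the epsilon-N unfolding of "the sup tends to 0"
   (the sup being finite eventually is part of this). *)
Definition UAR {M : Type} (d : M -> M -> R) (T : M -> M) : Prop :=
  forall eps : R, 0 < eps ->
    exists N : nat, forall n : nat, (N <= n)%nat ->
      forall x : M, d (iter_map (S n) T x) (iter_map n T x) <= eps.

(* Main.v *)
Require Import Defs.
From Stdlib Require Import Reals Lra.
Open Scope R_scope.

(* Surjectivity lets every point be written as x = T^N y for any N, so
   d(T x, x) = d(T^(N+1) y, T^N y), which uniform asymptotic regularity makes
   arbitrarily small. *)

Lemma iter_map_surjective (M : Type) (T : M -> M) :
  (forall y : M, exists x : M, T x = y) ->
  forall (n : nat) (x : M), exists y : M, iter_map n T y = x.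
Proof.
  intros T_surj n; induction n as [|n IH]; intros x.
  - exists x; reflexivity.
  - destruct (T_surj x) as [z Tz]; destruct (IH z) as [y Tny].
    exists y; simpl; rewrite Tny; exact Tz.
Qed.

Lemma metric_eq_of_le_all_pos (M : Type) (d : M -> M -> R) (x y : M) :
  is_metric d -> (forall eps : R, 0 < eps -> d x y <= eps) -> x = y.
Proof.
  intros [d_ge0 [d_eq0 _]] d_small; apply d_eq0.
  destruct (Rle_lt_or_eq_dec 0 _ (d_ge0 x y)) as [d_pos|d_0]; [|auto].
  specialize (d_small (d x y / 2) ltac:(lra)); lra.
Qed.

Theorem proposition2p2 (M : Type) (d : M -> M -> R) (T : M -> M) :
  is_metric d ->
  (forall y : M, exists x : M, T x = y) ->
  UAR d T ->
  forall x : M, T x = x.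
Proof.
  intros d_metric T_surj T_uar x.
  apply (metric_eq_of_le_all_pos M d _ _ d_metric); intros eps eps_pos.
  destruct (T_uar eps eps_pos) as [N HN].
  destruct (iter_map_surjective M T T_surj N x) as [y TNy].
  specialize (HN N (le_n N) y); simpl in HN; rewrite TNy in HN.
  exact HN.
Qed.
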